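(* Let $X$ be an infinite set and let $G$ be a group with $\mathrm{FAlt}(X)\leqslant G\leqslant \mathrm{Sym}(X)$. If no element $g\in G$ has an infinite orbit on $X$ (i.e. for every $g\in G$ and every $x\in X$ the set $\{xg^d\mid d\in\mathbb{Z}\}$ is finite), then $G$ has the $R_\infty$ property.
   Context: For a set $X$, $\mathrm{Sym}(X)$ is the group of all permutations of $X$ (acting on the right) and $\mathrm{FAlt}(X)$ is the subgroup of even permutations with finite support. For a group $G$ and $\phi\in\mathrm{Aut}(G)$, elements $a,b\in G$ are $\phi$-twisted conjugate if there is $x\in G$ with $(x^{-1})\phi\, a x=b$; the Reidemeister number $R(\phi)$ is the number of $\phi$-twisted conjugacy classes in $G$. $G$ has the $R_\infty$ property if $R(\phi)=\infty$ (infinitely many classes) for every $\phi\in\mathrm{Aut}(G)$. *)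

(* Defs.v *)
From HB Require Import structures.
From mathcomp Require Import all_boot ssralg ssrint.
From mathcomp Require Import boolp classical_sets functions cardinality.

Set Implicit Arguments.
Unset Strict Implicit.
Unset Printing Implicit Defensive.

Local Open Scope classical_set_scope.
Local Open Scope group_scope.

(* The inverse function is part of the data only for convenience: it is
   determined by [sym_fun] (see [symP]). *)
Record Sym (X : Type) := MkSym {
  sym_fun :> X -> X;
  sym_inv : X -> X;
  sym_funK : cancel sym_fun sym_inv;
  sym_invK : cancel sym_inv sym_fun
}.

Lemma symP (X : Type) (p q : Sym X) : p =1 q -> p = q.
Proof.
case: p q => [f f' fK f'K] [g g' gK g'K] /= /funext fg; subst g.
have ? : f' = g' by apply/funext => x; rewrite -[in LHS](g'K x) fK.
by subst g'; congr MkSym; exact: Prop_irrelevance.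
Qed.

HB.instance Definition _ (X : Type) := gen_eqMixin (Sym X).
HB.instance Definition _ (X : Type) := gen_choiceMixin (Sym X).

Section SymGroup.
Variable X : Type.
Implicit Types p q r : Sym X.

Definition sym_one : Sym X := @MkSym X id id (fun=> erefl) (fun=> erefl).

(* Permutations act on the right: x(pq) = (xp)q. *)
Definition sym_mul p q : Sym X :=
  MkSym (can_comp (sym_funK q) (sym_funK p))
        (can_comp (sym_invK p) (sym_invK q)).

Definition sym_invg p : Sym X := MkSym (sym_invK p) (sym_funK p).

Lemma sym_mulA : associative sym_mul. Proof. by move=> p q r; exact: symP. Qed.
Lemma sym_mul1 : left_id sym_one sym_mul. Proof. by move=> p; exact: symP. Qed.
Lemma sym_mulr1 : right_id sym_one sym_mul. Proof. by move=> p; exact: symP. Qed.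
Lemma sym_mulV : left_inverse sym_one sym_invg sym_mul.
Proof. by move=> p; apply: symP; exact: sym_invK. Qed.
Lemma sym_mulrV : right_inverse sym_one sym_invg sym_mul.
Proof. by move=> p; apply: symP; exact: sym_funK. Qed.

HB.instance Definition _ :=
  isGroup.Build (Sym X) sym_mulA sym_mul1 sym_mulr1 sym_mulV sym_mulrV.

End SymGroup.

Definition is_transposition (X : Type) (t : Sym X) : Prop :=
  exists x y : X,
    [/\ x <> y, t x = y, t y = x & forall z, z <> x -> z <> y -> t z = z].

Definition sym_even (X : Type) (p : Sym X) : Prop :=
  exists ts : seq (Sym X),
    [/\ ~~ odd (size ts), forall t, t \in ts -> is_transposition t
      & p = \prod_(t <- ts) t].

(* [sym_even p] already forces the support of [p] to be finite. *)
Definition FAlt (X : Type) : set (Sym X) :=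
  [set p : Sym X | finite_set [set x | p x <> x] /\ sym_even p].
Arguments FAlt X : clear implicits.

Definition expgz (gT : groupType) (g : gT) (d : int) : gT :=
  match d with Posz n => g ^+ n | Negz n => g ^- n.+1 end.

Definition sym_orbit (X : Type) (g : Sym X) (x : X) : set X :=
  [set expgz g d x | d in [set: int]].

Record subgroup (gT : groupType) (G : groupClosed gT) := MkSubgroup {
  subgroup_val :> gT;
  subgroup_valP : subgroup_val \in G
}.

Section SubgroupGroup.
Variables (gT : groupType) (G : groupClosed gT).

Lemma groupClosed_closed : group_closed G.
Proof.
split=> [|u v Gu Gv]; first exact: gpred1.
by apply: gpredM => //; exact: gpredVr.
Qed.

HB.instance Definition _ := [isSub for @subgroup_val gT G].
HB.instance Definition _ := [Choice of subgroup G by <:].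
HB.instance Definition _ :=
  SubChoice_isSubGroup.Build gT _ (subgroup G) groupClosed_closed.

End SubgroupGroup.

Section Reidemeister.
Variable gT : groupType.

(* [phi] is applied to x^-1: with maps written on the right, this is
   (x^-1)phi a x = b. *)
Definition twisted_conj (phi : gT -> gT) (a b : gT) : Prop :=
  exists x : gT, phi x^-1 * a * x = b.

Definition twisted_classes (phi : gT -> gT) : set (set gT) :=
  [set twisted_conj phi a | a in [set: gT]].

Definition R_infty : Prop :=
  forall phi : {multiplicative gT -> gT},
    bijective phi -> infinite_set (twisted_classes phi).

End Reidemeister.

(* Main.v *)
Require Import Defs.
From HB Require Import structures.
From mathcomp Require Import all_boot ssralg ssrint.
From mathcomp Require Import boolp classical_sets functions cardinality.

(** Let G be a group of permutations of X containing all finitary even ones, and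
let phi be an automorphism of G.

Every automorphism of G is conjugation by a permutation s of X
([automorphism_inner]).  Indeed the 3-cycles of G are singled out by their
abstract behaviour in G: u is a 3-cycle exactly when u has order 3 and
(u * u ^ h) ^+ 60 = 1 for every h in G ([three_cycle_like_of],
[three_cycle_of_like]).  So phi permutes the 3-cycles, and it preserves the pairs
of 3-cycles of the form (p q r), (p q s), because among pairs of 3-cycles these
are the ones whose product has order 2.  Applied to the family
(o1 o2 y), with o1 and o2 fixed and y variable, this gives images (p q t) with
p and q fixed; sending o1, o2, y to p, q, t defines s.

Since phi is conjugation by s, two elements a, b of G are twisted conjugate exactly
when s a and s b are conjugate by an element of G.  Suppose that g has only finite
orbits and conjugates t to t'.  It maps the fixed points of t onto those of t'; if
these two sets are comparable, a point lying in only one of them would never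
return under the iterates of g, so they are equal ([fixes_comparable_eq]).  Hence it
suffices to find an infinite sequence in the coset s G whose sets of fixed points
form a strict chain.  Multiplying by a 3-cycle does it: if there are infinitely many
fixed points, three of them can be made to move ([mul_cyc_fewer_fixes]), and
otherwise infinitely many points move and one of them can be made fixed while all
the old fixed points are kept ([mul_cyc_more_fixes]). *)

Set Implicit Arguments.
Unset Strict Implicit.
Unset Printing Implicit Defensive.

Local Open Scope classical_set_scope.
Local Open Scope group_scope.

(** * Evaluating permutations on pairwise distinct points *)

(** Computations with explicit 3-cycles are decided by splitting the distinctness
hypotheses into disequalities and rewriting every boolean equality between points
with them. *)
Ltac split_neqs :=
  repeat match goal with H : is_true (_ && _) |- _ =>
    let H1 := fresh in let H2 := fresh in move: H => /andP[H1 H2] end.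

Ltac eval_eqs :=
  repeat match goal with
  | H : is_true (?a != ?b) |- context [?a == ?b] => rewrite (negbTE H)
  | H : is_true (?a != ?b) |- context [?b == ?a] =>
      rewrite [b == a]eq_sym (negbTE H)
  | |- context [?a == ?a] => rewrite (eqxx a) end.

Ltac case_eq x a :=
  let E := fresh "E" in case: (eqVneq x a) => [E|E]; [subst x|]; eval_eqs.

(** Between groups, multiplicativity alone makes a map a group morphism. *)
Section MultiplicativeOnGroups.
Variables (gT hT : groupType) (f : {multiplicative gT -> hT}).

Lemma multiplicative1 : f 1 = 1.
Proof. by apply: (mulgI (f 1)); rewrite -gmulfM !mulg1. Qed.

Lemma multiplicativeV u : f u^-1 = (f u)^-1.
Proof. by apply: (mulgI (f u)); rewrite -gmulfM !mulgV multiplicative1. Qed.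

Lemma multiplicativeJ u v : f (u ^ v) = f u ^ f v.
Proof. by rewrite !conjgE !gmulfM multiplicativeV. Qed.

Lemma multiplicativeX u n : f (u ^+ n) = f u ^+ n.
Proof.
by elim: n => [|n IHn]; rewrite ?multiplicative1 // !expgS gmulfM IHn.
Qed.

End MultiplicativeOnGroups.

Section ThreeCycles.
Variable X : eqType.
Implicit Types (p q g h u v w : Sym X) (a b c d x y : X).

Lemma sym_mulE p q x : (p * q) x = q (p x).
Proof. by []. Qed.

Lemma sym_mulVE p x : p^-1 (p x) = x.
Proof. exact: sym_funK. Qed.

Lemma sym_mulEV p x : p (p^-1 x) = x.
Proof. exact: sym_invK. Qed.

Lemma sym_fun_inj p : injective p.
Proof. exact: can_inj (sym_funK p). Qed.

Lemma sym_expE p n x : (p ^+ n) x = iter n p x.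
Proof. by elim: n x => // n IHn x; rewrite expgSr sym_mulE IHn. Qed.

Lemma sym_conjE g h x : (g ^ h) (h x) = h (g x).
Proof. by rewrite conjgE !sym_mulE sym_mulVE. Qed.

Definition swap_fun a b x := if x == a then b else if x == b then a else x.

Lemma swap_funK a b : involutive (swap_fun a b).
Proof.
move=> x; rewrite /swap_fun.
case: (eqVneq x a) => [->|xa]; first by rewrite eqxx; case: (eqVneq b a).
case: (eqVneq x b) => [->|xb]; first by rewrite eqxx.
by rewrite (negbTE xa) (negbTE xb).
Qed.

Definition swap a b : Sym X := MkSym (swap_funK a b) (swap_funK a b).

Lemma swapJ a b h : swap a b ^ h = swap (h a) (h b).
Proof.
apply: symP => x; rewrite -(sym_mulEV h x) sym_conjE.
rewrite /= /swap_fun !(inj_eq (@sym_fun_inj h)).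
by case: ifP => // _; case: ifP.
Qed.

(** As permutations act on the right, this product maps a to b, b to c and c to a
when the three points are distinct. *)
Definition cyc a b c := swap a b * swap a c.

Lemma cycE a b c x : uniq [:: a; b; c] ->
  cyc a b c x =
    if x == a then b else if x == b then c else if x == c then a else x.
Proof.
rewrite /= !inE !negb_or => H; split_neqs; rewrite /swap_fun.
by case_eq x a; first by []; case_eq x b.
Qed.

Lemma cyc_1 a b c : uniq [:: a; b; c] -> cyc a b c a = b.
Proof. by move=> abc; rewrite cycE // eqxx. Qed.

Lemma cyc_2 a b c : uniq [:: a; b; c] -> cyc a b c b = c.
Proof.
move=> abc; rewrite cycE //.
by move: abc; rewrite /= !inE !negb_or => H; split_neqs; eval_eqs.
Qed.

Lemma cyc_3 a b c : uniq [:: a; b; c] -> cyc a b c c = a.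
Proof.
move=> abc; rewrite cycE //.
by move: abc; rewrite /= !inE !negb_or => H; split_neqs; eval_eqs.
Qed.

Lemma cycJ a b c h : cyc a b c ^ h = cyc (h a) (h b) (h c).
Proof. by rewrite /cyc conjMg !swapJ. Qed.

Lemma cycV a b c : (cyc a b c)^-1 = cyc a c b.
Proof. by apply: symP. Qed.

Lemma uniq_rot3 a b c : uniq [:: a; b; c] -> uniq [:: b; c; a].
Proof. by rewrite -(rot_uniq 1). Qed.

Lemma uniq_flip3 a b c : uniq [:: a; b; c] -> uniq [:: a; c; b].
Proof. by rewrite /= !inE orbC [c == b]eq_sym. Qed.

Lemma cyc_rot a b c : uniq [:: a; b; c] -> cyc a b c = cyc b c a.
Proof.
move=> abc; apply: symP => x; rewrite cycE // cycE ?(uniq_rot3 abc) //.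
move: abc; rewrite /= !inE !negb_or => H; split_neqs.
by case_eq x a; first by []; case_eq x b.
Qed.

Lemma cyc_out a b c x : uniq [:: a; b; c] ->
  x \notin [:: a; b; c] -> cyc a b c x = x.
Proof.
move=> abc; rewrite !inE !negb_or cycE // => H; split_neqs.
by eval_eqs.
Qed.

Lemma FAlt_cyc a b c : uniq [:: a; b; c] -> FAlt X (cyc a b c).
Proof.
move=> abc; split.
  apply: (@sub_finite_set _ _ [set` [:: a; b; c]]); last exact: finite_seq.
  by move=> x /= cx; apply: contra_notT cx; exact: cyc_out.
exists [:: swap a b; swap a c]; split=> //; last first.
  by rewrite big_cons big_seq1.
have istr d e : d != e -> is_transposition (swap d e).
  move=> de; exists d, e; split; rewrite /= /swap_fun; eval_eqs => //.
    exact/eqP.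
  by move=> z /eqP/negbTE-> /eqP/negbTE->.
move: abc => /= ; rewrite !inE !negb_or => H; split_neqs.
by move=> t; rewrite !inE => /orP[]/eqP->; apply: istr.
Qed.

Arguments cyc : simpl never.

(** * Three-cycles and their orders *)

Definition three_cycle w := exists a b c, uniq [:: a; b; c] /\ w = cyc a b c.

Lemma three_cycle_at w x : three_cycle w -> w x != x ->
  exists b c, uniq [:: x; b; c] /\ w = cyc x b c.
Proof.
case=> a [b [c [abc ->]]] wx.
have: x \in [:: a; b; c] by apply: contraNT wx => /cyc_out->.
have bca := uniq_rot3 abc; have cab := uniq_rot3 bca.
rewrite !inE => /or3P[]/eqP->.
- by exists b, c.
- by exists c, a; split=> //; exact: cyc_rot.
- by exists a, b; split=> //; rewrite (cyc_rot abc) (cyc_rot bca).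
Qed.

(** Pigeonhole principle: among the first size s + 1 iterates two coincide, and
injectivity of the permutation cancels the common part. *)
Lemma iter_return p (s : seq X) x : (forall i, iter i p x \in s) ->
  exists2 d : nat, (0 < d <= size s)%N & iter d p x = x.
Proof.
move=> in_s; have: looping p x (size s).
  rewrite -[looping _ _ _]negbK -looping_uniq; apply/negP => U.
  have sub : {subset traject p x (size s).+1 <= s} by move=> y /trajectP[i _ ->].
  by have := uniq_leq_size U sub; rewrite size_traject ltnn.
move=> /trajectP[i i_s ei]; exists (size s - i)%N.
  by rewrite subn_gt0 i_s leq_subr.
by apply: (@sym_fun_inj (p ^+ i)); rewrite !sym_expE -iterD subnKC // ltnW.
Qed.

(** A point of the support has an orbit inside the support, hence of length at most
the number of points of s. *)
Lemma small_support_exp p (s : seq X) (m : nat) :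
  (forall d : nat, (0 < d <= size s)%N -> (d %| m)%N) ->
  (forall x, x \notin s -> p x = x) -> p ^+ m = 1.
Proof.
move=> dvm ps; apply: symP => x; rewrite sym_expE.
suff [d dm dx] : exists2 d : nat, (d %| m)%N & iter d p x = x.
  rewrite -(divnK dm); elim: (m %/ d)%N => // n IHn.
  by rewrite mulSn addnC iterD dx.
have [xs|xs] := boolP (x \in s); last first.
  by exists 1%N; [exact: dvd1n | exact: ps].
have in_s i : iter i p x \in s.
  elim: i => [|i IHi] //=; apply: contraLR (IHi) => pys.
  by rewrite -(sym_fun_inj (ps _ pys)).
by have [d ds dx] := iter_return in_s; exists d => //; exact: dvm.
Qed.

(** The product moves at most six points, and 60 is the least common multiple of
1, ..., 6. *)
Lemma three_cycle_exp60 u v : three_cycle u -> three_cycle v ->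
  (u * v) ^+ 60 = 1.
Proof.
move=> [a [b [c [abc ->]]]] [d [e [f [def ->]]]].
apply: (@small_support_exp _ [:: a; b; c; d; e; f]); first by do 7?case.
move=> x xs.
move: (xs); rewrite -[_ :: _]/([:: a; b; c] ++ [:: d; e; f]) mem_cat negb_or.
by case/andP=> x1 x2; rewrite sym_mulE !cyc_out.
Qed.

Lemma cyc_exp3 a b c : uniq [:: a; b; c] -> cyc a b c ^+ 3 = 1.
Proof.
move=> abc; apply: symP => x; rewrite sym_expE /=.
have E := fun x => cycE x abc; rewrite -!/(cyc a b c _).
move: abc E; rewrite /= !inE !negb_or => H E; split_neqs.
have [->|xa] := eqVneq x a; first by rewrite !E; eval_eqs.
have [->|xb] := eqVneq x b; first by rewrite !E; eval_eqs.
by have [->|xc] := eqVneq x c; rewrite !E; eval_eqs.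
Qed.

Lemma exp3_orbit g x : g ^+ 3 = 1 -> g x != x ->
  g (g (g x)) = x /\ uniq [:: x; g x; g (g x)].
Proof.
move=> g3 gx; have ggg : g (g (g x)) = x by rewrite -[RHS]/((1 : Sym X) x) -g3.
split=> //; rewrite /= !inE !negb_or (inj_eq (@sym_fun_inj g)) [x == _]eq_sym gx.
rewrite /= andbT; apply: contra gx => /eqP E.
by rewrite {1}E ggg.
Qed.

Lemma uniq_image3 (sigma : X -> X) a b c : injective sigma ->
  uniq [:: a; b; c] -> uniq [:: sigma a; sigma b; sigma c].
Proof.
by move=> sI; rewrite -[X in _ -> X]/(uniq (map sigma [:: a; b; c]) = true)
   map_inj_uniq.
Qed.

Lemma cyc_injective_image (sigma : X -> X) a b c x : injective sigma ->
  uniq [:: a; b; c] ->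
  sigma (cyc a b c x) = cyc (sigma a) (sigma b) (sigma c) (sigma x).
Proof.
move=> sI abc; have sabc := uniq_image3 sI abc.
by rewrite !cycE // !(inj_eq sI) !(fun_if sigma).
Qed.

Lemma uniq_cat_orbit3 g (s : seq X) x : g ^+ 3 = 1 -> uniq s ->
  (forall y, y \in s -> g y \in s) -> x \notin s -> g x != x ->
  uniq (s ++ [:: x; g x; g (g x)]).
Proof.
move=> g3 us gs xs gx; have [gggx xgg] := exp3_orbit g3 gx.
rewrite cat_uniq us xgg andbT andTb; apply/hasPn => y; rewrite !inE.
have ggx : g (g x) \notin s by apply: contra xs => /gs; rewrite gggx.
have gx' : g x \notin s by apply: contra ggx => /gs.
by move=> /or3P[] /eqP->.
Qed.

Lemma exp_not1 g x n m r : iter n g x = x -> iter r g x != x ->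
  g ^+ (m * n + r) != 1.
Proof.
move=> gn; apply: contra => /eqP g1; rewrite -[X in _ == X]/((1 : Sym X) x) -g1.
rewrite sym_expE addnC iterD.
by elim: m {g1} => //= m; rewrite mulSn addnC iterD gn.
Qed.

(** * Pairs of three-cycles with a common arrow *)

(** For two 3-cycles this says that they have the form (p q r), (p q s) with r and s
distinct, i.e. that they agree at exactly one of the points they move (see
[linked_cyc] and [linked_shape]).  It is phrased inside the group, so that
automorphisms preserve it. *)
Definition linked (gT : groupType) (u v : gT) : Prop :=
  [/\ (u * v) ^+ 2 = 1, u <> v & u * v <> 1].

Lemma linked_cyc a b c d : uniq [:: a; b; c; d] ->
  linked (cyc a b c) (cyc a b d).
Proof.
move=> abcd.
have [abc abd] : uniq [:: a; b; c] /\ uniq [:: a; b; d].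
  move: abcd; rewrite /= !inE !negb_or => H; split_neqs.
  by split; eval_eqs.
have E := (fun x => cycE x abc, fun x => cycE x abd).
move: abcd; rewrite /= !inE !negb_or => H; split_neqs; split.
- apply: symP => x.
  rewrite -[LHS]/(cyc a b d (cyc a b c (cyc a b d (cyc a b c x)))) !E.
  case_eq x a; first by [].
  case_eq x b; first by [].
  case_eq x c; first by [].
  by case_eq x d.
- move=> uv; have := congr1 (fun p : Sym X => p b) uv; rewrite !E; eval_eqs => /eqP.
  by eval_eqs.
- move=> uv; have := congr1 (fun p : Sym X => p a) uv.
  rewrite sym_mulE !E; eval_eqs => /eqP.
  by rewrite -[X in _ == X]/a; eval_eqs.
Qed.

(** Apart from equal, inverse and linked 3-cycles, two 3-cycles with a common point
have a product u * w whose square moves a or b, according to how their supports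
meet. *)
Lemma linked_at a b c d e :
  uniq [:: a; b; c] -> uniq [:: a; d; e] -> linked (cyc a b c) (cyc a d e) ->
  exists2 t, t \notin [:: a; b; c] &
    cyc a d e = cyc a b t \/ cyc a d e = cyc c a t.
Proof.
move=> abc ade [uw2 uw uw1].
have sq x : cyc a d e (cyc a b c (cyc a d e (cyc a b c x))) = x.
  by rewrite -[RHS]/((1 : Sym X) x) -uw2.
have E := (fun x => cycE x abc, fun x => cycE x ade).
move: (abc) (ade); rewrite /= !inE !negb_or => N1 N2; split_neqs.
case: (eqVneq d b) => [db|db].
  subst d; exists e; last by left.
  rewrite !inE !negb_or; eval_eqs => //=.
  by apply: contra_not_neq uw => ->.
case: (eqVneq e b) => [eb|eb].
  subst e; case: (eqVneq d c) => [dc|dc].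
    by case: uw1; rewrite dc -cycV mulgV.
  by have := sq b; rewrite !E; do 3!(eval_eqs; rewrite ?E) => /eqP; eval_eqs.
case: (eqVneq d c) => [dc|dc].
  subst d.
  by have := sq a; rewrite !E; do 3!(eval_eqs; rewrite ?E) => /eqP; eval_eqs.
case: (eqVneq e c) => [ec|ec].
  subst e; exists d; first by rewrite !inE !negb_or; eval_eqs.
  by right; rewrite [RHS]cyc_rot //; exact: uniq_rot3 (uniq_rot3 ade).
by have := sq a; rewrite !E; do 3!(eval_eqs; rewrite ?E) => /eqP; eval_eqs.
Qed.

(** A 3-cycle w disjoint from u = (p q r) commutes with u, so that (u * w) ^+ 2 is not
1; hence w moves one of p, q, r, and [linked_at] applies at that point. *)
Lemma linkedP (p q r : X) w : uniq [:: p; q; r] -> three_cycle w ->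
  linked (cyc p q r) w -> exists2 t, t \notin [:: p; q; r] &
    [\/ w = cyc p q t, w = cyc q r t | w = cyc r p t].
Proof.
move=> pqr cw L.
have qrp := uniq_rot3 pqr; have rpq := uniq_rot3 qrp.
have [wp|wp] := eqVneq (w p) p; last first.
  have [d [e [pde wE]]] := three_cycle_at cw wp.
  rewrite wE in L *; have [t tN [->|->]] := linked_at pqr pde L; exists t => //.
    by constructor 1.
  by constructor 3.
have [wq|wq] := eqVneq (w q) q; last first.
  have [d [e [qde wE]]] := three_cycle_at cw wq.
  rewrite wE (cyc_rot pqr) in L *.
  have [t tN [->|->]] := linked_at qrp qde L; exists t;
    by rewrite -?(mem_rot 1 [:: p; q; r]) //; constructor.
have [wr|wr] := eqVneq (w r) r; last first.
  have [d [e [rde wE]]] := three_cycle_at cw wr.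
  rewrite wE -(cyc_rot rpq) in L *.
  have [t tN [->|->]] := linked_at rpq rde L; exists t;
    by rewrite -?(mem_rot 2 [:: p; q; r]) //; constructor.
(* Here w fixes p, q and r, so that (u * w) ^+ 2 sends p to r. *)
case: L => sq _ _; have E := fun x => cycE x pqr.
have wE : w (cyc p q r (w (cyc p q r p))) = p.
  by rewrite -[RHS]/((1 : Sym X) p) -sq.
move: (pqr); rewrite /= !inE !negb_or => N; split_neqs.
have [Ep Eq] : cyc p q r p = q /\ cyc p q r q = r by rewrite !E; eval_eqs.
by move: wE; rewrite Ep wq Eq wr => /eqP; eval_eqs.
Qed.

Lemma linked_shape u w : three_cycle u -> three_cycle w -> linked u w ->
  exists p q r s : X, [/\ uniq [:: p; q; r; s], u = cyc p q r & w = cyc p q s].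
Proof.
move=> [a [b [c [abc ->]]]] cw L.
have bca := uniq_rot3 abc; have cab := uniq_rot3 bca.
have [t tN wt] := linkedP abc cw L.
have uniq4 (x y z v : X) : uniq [:: x; y; z] -> v \notin [:: x; y; z] ->
    uniq [:: x; y; z; v].
  by move=> xyz vN; rewrite -(rot_uniq 3) cons_uniq vN xyz.
case: wt => ->; [exists a, b, c, t|exists b, c, a, t|exists c, a, b, t].
- by split=> //; exact: uniq4.
- split=> //; last exact: cyc_rot.
  by apply: uniq4; rewrite // -?(mem_rot 1 [:: a; b; c]) in tN *.
- split=> //; last by rewrite (cyc_rot abc) (cyc_rot bca).
  by apply: uniq4; rewrite // -?(mem_rot 2 [:: a; b; c]) in tN *.
Qed.

(** The arrow shared with (p q r) and the arrow shared with (p q s) must be the same: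
no 3-cycle contains one of q -> r, r -> p together with one of q -> s, s -> p.  This
makes the pair (p, q) a common invariant of a whole family
of pairwise linked 3-cycles. *)
Lemma linked_common (p q r s : X) w : uniq [:: p; q; r; s] ->
  three_cycle w -> linked (cyc p q r) w -> linked (cyc p q s) w ->
  exists2 t, uniq [:: p; q; t] & w = cyc p q t.
Proof.
move=> pqrs cw Lr Ls.
have [pqr pqs] : uniq [:: p; q; r] /\ uniq [:: p; q; s].
  move: pqrs; rewrite /= !inE !negb_or => N; split_neqs.
  by split; eval_eqs.
have [t tN wt] := linkedP pqr cw Lr; have [t' t'N wt'] := linkedP pqs cw Ls.
move: pqrs tN t'N; rewrite /= !inE !negb_or => N N1 N2; split_neqs.
have pqt : uniq [:: p; q; t] by rewrite /= !inE; eval_eqs.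
have qrt : uniq [:: q; r; t] by rewrite /= !inE; eval_eqs.
have rpt : uniq [:: r; p; t] by rewrite /= !inE; eval_eqs.
have pqt' : uniq [:: p; q; t'] by rewrite /= !inE; eval_eqs.
have qst' : uniq [:: q; s; t'] by rewrite /= !inE; eval_eqs.
have spt' : uniq [:: s; p; t'] by rewrite /= !inE; eval_eqs.
have neq (x y : X) : x = y -> x != y -> exists2 t, uniq [:: p; q; t] & w = cyc p q t.
  by move=> ->; rewrite eqxx.
case: wt => [w1|w1|w1]; first by exists t.
- have wp : w p = p by rewrite w1 cyc_out // !inE; eval_eqs.
  case: wt' => [w2|w2|w2]; first by exists t'.
  + by apply: (neq r s) => //; rewrite -(cyc_1 qrt) -w1 w2 cyc_1.
  + by apply: (neq p t') => //; rewrite -1?eq_sym // -[LHS]wp w2 cyc_2.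
- have wq : w q = q by rewrite w1 cyc_out // !inE; eval_eqs.
  case: wt' => [w2|w2|w2]; first by exists t'.
  + by apply: (neq q s) => //; rewrite -[LHS]wq w2 cyc_1.
  + apply: (neq r s) => //; apply: (@sym_fun_inj w).
    by rewrite {2}w2 cyc_1 // w1 cyc_1.
Qed.

End ThreeCycles.

(** * Fixed points and conjugation by permutations with finite orbits *)

Section FixedPoints.
Variable X : eqType.
Implicit Types (t g : Sym X) (x y : X).

Definition fixes t : set X := [set x | t x = x].

Lemma finite_orbit_return g x : finite_set (sym_orbit g x) ->
  exists2 d : nat, (0 < d)%N & iter d g x = x.
Proof.
move=> /finite_seqP[s sE]; have [|d /andP[d0 _] dx] := @iter_return _ g s x.
  move=> i; have: [set` s] (iter i g x); last by [].
  by rewrite -sE; exists (Posz i) => //; rewrite -sym_expE.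
by exists d.
Qed.

(** Conjugation by g carries the fixed points of t onto those of t ^ g.  If one of the
two sets contained the other strictly, then iterating g on a point of the
difference would stay forever away from that point. *)
Lemma fixes_comparable_eq t g :
  (forall x, finite_set (sym_orbit g x)) ->
  fixes t `<=` fixes (t ^ g) \/ fixes (t ^ g) `<=` fixes t ->
  fixes t = fixes (t ^ g).
Proof.
move=> fin_g; have fixJ y : fixes (t ^ g) (g y) <-> fixes t y.
  by rewrite /fixes /mkset sym_conjE; split=> [/sym_fun_inj|->].
case=> sub; apply/seteqP; split=> // y.
  move=> fy; apply: contrapT => nfy.
  have [[//|d] _ dy] := finite_orbit_return (fin_g y).
  suff nf i : ~ fixes t (iter i g y) by move: fy; rewrite -dy /= => /fixJ/nf.
  by elim: i => [|i IHi] //= /sub/fixJ.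
move=> fy; have [[//|d] _ dy] := finite_orbit_return (fin_g y).
rewrite -dy /=; apply/fixJ; elim: d {dy} => [|d IHd] //=.
by apply/sub/fixJ.
Qed.

(** Infinite sets, in the form in which points are picked from them: this is
stable under a change of finitely many points. *)
Definition unbounded (A : set X) := forall s : seq X, exists2 x, x \notin s & A x.

Lemma unbounded3 A : unbounded A ->
  exists a b c, [/\ uniq [:: a; b; c], A a, A b & A c].
Proof.
move=> uA; have [a _ Aa] := uA [::]; have [b bN Ab] := uA [:: a].
have [c cN Ac] := uA [:: a; b]; exists a, b, c; split=> //.
by move: bN cN; rewrite /= !inE !negb_or => N N1; split_neqs; eval_eqs.
Qed.

(** The cycle is taken on three fixed points of t: those become moved, and nothing
else changes. *)
Lemma mul_cyc_fewer_fixes t : unbounded (fixes t) ->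
  exists a b c, [/\ uniq [:: a; b; c],
    fixes (t * cyc a b c) `<` fixes t & unbounded (fixes (t * cyc a b c))].
Proof.
move=> ut; have [a [b [c [abc ta tb tc]]]] := unbounded3 ut.
exists a, b, c; split=> //.
  split; last first.
    move=> /(_ a ta); rewrite /fixes /mkset sym_mulE ta cyc_1 // => ba.
    by move: abc; rewrite ba /= !inE eqxx.
  move=> x; rewrite /fixes /mkset sym_mulE => cx.
  have [tx|tx] := boolP (t x \in [:: a; b; c]); last by rewrite cyc_out in cx.
  apply: (@sym_fun_inj _ t); move: tx.
  by rewrite !inE => /or3P[] /eqP->; rewrite ?ta ?tb ?tc.
move=> s; have [x xN tx] := ut ([:: a; b; c] ++ s); exists x.
  by apply: contra xN; rewrite mem_cat orbC => ->.
rewrite /fixes /mkset sym_mulE tx cyc_out //; apply: contra xN.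
by rewrite mem_cat => ->.
Qed.

(** If a is moved by t, then so is b = t a, and following t by a cycle that sends b
back to a fixes a.  The third point d of the cycle must be moved by t, so that no
fixed point of t is lost. *)
Lemma mul_cyc_more_fixes t : unbounded (~` fixes t) ->
  exists a b c, [/\ uniq [:: a; b; c],
    fixes t `<` fixes (t * cyc a b c) & unbounded (~` fixes (t * cyc a b c))].
Proof.
move=> ut; have [a _ ta] := ut [::]; have [d dN td] := ut [:: a; t a].
set b := t a in dN *.
have tb : ~ fixes t b by move=> /sym_fun_inj.
have bad : uniq [:: b; a; d].
  have ba : b != a by exact/eqP.
  by move: dN; rewrite /= !inE !negb_or => N; split_neqs; eval_eqs.
exists b, a, d; split=> //.
  split; last first.
    move=> /(_ a); apply: contra_not ta; apply.
    by rewrite /fixes /mkset sym_mulE cyc_1.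
  move=> x tx; rewrite /fixes /mkset sym_mulE tx cyc_out //.
  by apply: contraPN tx; rewrite !inE => /or3P[] /eqP->.
move=> s; have [x xN tx] := ut (map (sym_inv t) [:: b; a; d] ++ s); exists x.
  by apply: contra xN; rewrite mem_cat orbC => ->.
rewrite /fixes /setC /mkset sym_mulE cyc_out //; apply: contra xN.
rewrite mem_cat => txs.
by apply/orP; left; rewrite -(sym_funK t x) map_f.
Qed.

End FixedPoints.

(** * The three-cycles of G characterized inside G *)

(** Among permutations, the elements of this kind are the 3-cycles; the exponent 60
is the one of [three_cycle_exp60]. *)
Definition three_cycle_like (gT : groupType) (u : gT) : Prop :=
  [/\ u <> 1, u ^+ 3 = 1 & forall h, (u * u ^ h) ^+ 60 = 1].

Section SubgroupsContainingFAlt.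
Variables (X : eqType) (G : groupClosed (Sym X)).
Hypothesis X_infinite : forall s : seq X, exists x, x \notin s.
Hypothesis cycG : forall a b c, uniq [:: a; b; c] -> cyc a b c \in G.

Let H : groupType := subgroup G.
Implicit Types (u v w : H) (a b c d x y : X).

Lemma svM u v : val (u * v) = val u * val v.
Proof. by []. Qed.

Lemma svV u : val u^-1 = (val u)^-1.
Proof. by []. Qed.

Lemma svJ u v : val (u ^ v) = val u ^ val v.
Proof. by []. Qed.

Lemma sv1 : val (1 : H) = 1.
Proof. by []. Qed.

Lemma svX u n : val (u ^+ n) = val u ^+ n.
Proof. by elim: n => // n IHn; rewrite !expgS svM IHn. Qed.

Lemma three_cycle_like_of u : three_cycle (val u) -> three_cycle_like u.
Proof.
move=> cu; have [a [b [c [abc uE]]]] := cu; split.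
- move=> u1; move: uE; rewrite u1 => /(congr1 (fun p : Sym X => p a)).
  rewrite cycE // eqxx => /= ab.
  by move: abc; rewrite /= ab inE eqxx.
- by apply: val_inj; rewrite svX uE cyc_exp3.
- move=> h; apply: val_inj; rewrite svX svM svJ three_cycle_exp60 //.
  exists (val h a), (val h b), (val h c); rewrite uE cycJ; split=> //.
  by apply: uniq_image3 abc; exact: sym_fun_inj.
Qed.

(** Suppose that u of order 3 has two cycles (a b c), (d e f), and let z be a further
point.  On six points such elements cannot be told from 3-cycles, because an outer
automorphism of the alternating group of degree 6 exchanges the two classes; this
is why z is needed.  Conjugating by h = (a b d)(b c z), one finds in u * u ^ h a cycle
of length 7 if u fixes z and of length 9 if u moves z, and neither length divides
60. *)
Lemma three_cycle_of_like u : three_cycle_like u -> three_cycle (val u).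
Proof.
case=> u1 u3 u60; set g := val u.
have g3 : g ^+ 3 = 1 by rewrite -svX u3.
have [a ga] : exists a, g a != a.
  apply: contra_notP u1 => /forallNP gid; apply: val_inj; apply: symP => x.
  by have /negP := gid x; rewrite negbK => /eqP.
have [ggga abc] := exp3_orbit g3 ga.
set b := g a in ggga abc; set c := g b in ggga abc.
apply: contrapT => ncyc.
have [d gd] : exists d, g d != cyc a b c d.
  apply: contra_notP ncyc => /forallNP gE; exists a, b, c; split=> //.
  by apply: symP => x; have /negP := gE x; rewrite negbK => /eqP.
have dabc : d \notin [:: a; b; c].
  apply: contra gd; rewrite cycE // !inE => /or3P[]/eqP->.
  - by rewrite eqxx.
  - by move: abc; rewrite /= !inE !negb_or => N; split_neqs; eval_eqs.
  - by move: abc; rewrite /= !inE !negb_or => N; split_neqs; eval_eqs; apply/eqP.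
rewrite (cyc_out abc dabc) in gd.
have [gggd def] := exp3_orbit g3 gd.
set e := g d in gggd def; set f := g e in gggd def.
have abc_closed y : y \in [:: a; b; c] -> g y \in [:: a; b; c].
  by rewrite !inE => /or3P[]/eqP->; rewrite -/b -/c ?ggga eqxx ?orbT.
have abcdef : uniq [:: a; b; c; d; e; f].
  exact: uniq_cat_orbit3 g3 abc abc_closed dabc gd.
have [z zN] := X_infinite [:: a; b; c; d; e; f].
have uz : uniq [:: z; a; b; c; d; e; f] by rewrite cons_uniq zN.
have [abd bcz] : uniq [:: a; b; d] /\ uniq [:: b; c; z].
  move: uz; rewrite /= !inE !negb_or => N; split_neqs.
  by split; eval_eqs.
pose h : H := MkSubgroup (cycG abd) * MkSubgroup (cycG bcz).
have := u60 h; move/(congr1 val); rewrite svX svM svJ -/g.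
set k := g * _.
have kE x : k x = cyc b c z (cyc a b d (g (cyc a d b (cyc b z c (g x))))).
  by rewrite /k conjgE [val h]svM invgM !cycV.
have cE := (fun x => cycE x abd, fun x => cycE x (uniq_flip3 abd),
           fun x => cycE x bcz, fun x => cycE x (uniq_flip3 bcz)).
have gE : (g a = b) * (g b = c) * (g c = a) * (g d = e) * (g e = f) * (g f = d).
  by [].
case: (eqVneq (g z) z) => [gz|gz].
  (* The cycle of k is (a b d f z c e), and 60 = 8 * 7 + 4. *)
  suff /negP kN1 : k ^+ (8 * 7 + 4) != 1 by move=> k1; apply: kN1; apply/eqP.
  suff [k7 k4] : iter 7 k a = a /\ iter 4 k a != a by exact: exp_not1 k7 k4.
  clearbody k b c e f; move: uz; rewrite /= !inE !negb_or => N; split_neqs.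
  have kval : (k a = b) * (k b = d) * (k d = f) * (k f = z) * (k z = c)
              * (k c = e) * (k e = a).
    by do ![split]; rewrite kE; do 3!(rewrite ?gE ?gz ?cE; eval_eqs).
  by rewrite /= !kval; split=> //; eval_eqs.
have closed y : y \in [:: a; b; c; d; e; f] -> g y \in [:: a; b; c; d; e; f].
  by rewrite !inE => /or4P[||| /or3P[]] /eqP->; rewrite gE eqxx ?orbT.
have u9 := uniq_cat_orbit3 g3 abcdef closed zN gz.
have [gggz _] := exp3_orbit g3 gz.
set i := g z in gz u9 gggz; set j := g i in u9 gggz.
(* The cycle of k is (a i b d f z j c e), and 60 = 6 * 9 + 6. *)
have gE' : (g z = i) * (g i = j) * (g j = z) by [].
suff /negP kN1 : k ^+ (6 * 9 + 6) != 1 by move=> k1; apply: kN1; apply/eqP.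
suff [k9 k6] : iter 9 k a = a /\ iter 6 k a != a by exact: exp_not1 k9 k6.
clearbody k b c e f i j; move: u9; rewrite /= !inE !negb_or => N; split_neqs.
have kval : (k a = i) * (k i = b) * (k b = d) * (k d = f) * (k f = z) * (k z = j)
            * (k j = c) * (k c = e) * (k e = a).
  by do ![split]; rewrite kE; do 3!(rewrite ?gE ?gE' ?cE; eval_eqs).
by rewrite /= !kval; split=> //; eval_eqs.
Qed.

(** A point a moved by w is seen on the cycle (a b c) with b = w a: it maps b to c,
whereas its conjugate by w maps b to w b. *)
Lemma central_on_cycles (w : Sym X) :
  (forall a b c, uniq [:: a; b; c] -> cyc a b c ^ w = cyc a b c) -> w = 1.
Proof.
move=> wC; apply: symP => a; apply: contrapT => /eqP wa.
rewrite -[X in _ != X]/a in wa; set b := w a in wa.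
have [c cN] := X_infinite [:: a; b; w b].
have abc : uniq [:: a; b; c].
  by move: cN; rewrite /= !inE !negb_or => N; split_neqs; eval_eqs.
have := wC a b c abc; move/(congr1 (fun p : Sym X => p b)).
rewrite sym_conjE cyc_1 // cyc_2 // => bc.
by move: cN; rewrite -bc !inE eqxx !orbT.
Qed.

(** * Automorphisms of G are conjugations *)

Section Automorphism.
Variable phi : {multiplicative H -> H}.
Hypothesis phi_bij : bijective phi.

(** The 3-cycle as an element of G; the default value 1 is reached only when the three
points are not distinct. *)
Definition cycH a b c : H := insubd 1 (cyc a b c).

Lemma val_cycH a b c : uniq [:: a; b; c] -> val (cycH a b c) = cyc a b c.
Proof. by move=> abc; rewrite /cycH insubdK //; exact: cycG. Qed.

Lemma cycHJ a b c u : uniq [:: a; b; c] ->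
  cycH a b c ^ u = cycH (val u a) (val u b) (val u c).
Proof.
move=> abc; apply: val_inj; rewrite svJ !val_cycH ?cycJ //.
by apply: uniq_image3 abc; exact: sym_fun_inj.
Qed.

Lemma phi_three_cycle u : three_cycle (val (phi u)) <-> three_cycle (val u).
Proof.
have phi_inj := bij_inj phi_bij; have [psi _ psiK] := phi_bij.
have phi_eq1 v : (phi v = 1) <-> (v = 1).
  by split=> [v1|->]; [apply: phi_inj; rewrite v1|]; rewrite multiplicative1.
have phi_like : three_cycle_like (phi u) <-> three_cycle_like u.
  split=> -[u1 u3 u60]; split.
  - by move=> /phi_eq1.
  - by apply/phi_eq1; rewrite multiplicativeX.
  - by move=> h; apply/phi_eq1; rewrite multiplicativeX gmulfM multiplicativeJ.
  - by move=> /phi_eq1.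
  - by rewrite -multiplicativeX u3 multiplicative1.
  - move=> h; rewrite -(psiK h) -multiplicativeJ -gmulfM -multiplicativeX u60.
    exact: multiplicative1.
by split=> /three_cycle_like_of/phi_like/three_cycle_of_like.
Qed.

Lemma phi_linked u v : linked (val u) (val v) ->
  linked (val (phi u)) (val (phi v)).
Proof.
have phi_inj := bij_inj phi_bij.
case=> uv2 uv uv1; split.
- rewrite -svM -svX -gmulfM -multiplicativeX -sv1 -(multiplicative1 phi).
  by congr (val (phi _)); apply: val_inj; rewrite svX svM uv2.
- by move=> /val_inj/phi_inj uv'; rewrite uv' in uv.
- rewrite -svM -gmulfM -sv1 -(multiplicative1 phi) => /val_inj/phi_inj uv1'.
  by apply: uv1; rewrite -svM uv1'.
Qed.

(** The cycles (o1 o2 y) are pairwise linked, so two of their images share an arrow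
p -> q, and by [linked_common] all the other images contain the same arrow. *)
Lemma phi_pivot o1 o2 : o1 != o2 -> exists p q, forall y, uniq [:: o1; o2; y] ->
  exists2 t, uniq [:: p; q; t] & val (phi (cycH o1 o2 y)) = cyc p q t.
Proof.
move=> o12.
have [y0 y0N] := X_infinite [:: o1; o2].
have [z0 z0N] := X_infinite [:: o1; o2; y0].
have uyz : uniq [:: o1; o2; y0; z0].
  move: y0N z0N; rewrite /= !inE !negb_or => N1 N2; split_neqs.
  by eval_eqs.
have L y z : uniq [:: o1; o2; y; z] ->
    linked (val (phi (cycH o1 o2 y))) (val (phi (cycH o1 o2 z))).
  move=> u; apply: phi_linked; rewrite !val_cycH; first exact: linked_cyc.
    by move: u; rewrite /= !inE !negb_or => N; split_neqs; eval_eqs.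
  by move: u; rewrite /= !inE !negb_or => N; split_neqs; eval_eqs.
have C3 y : uniq [:: o1; o2; y] -> three_cycle (val (phi (cycH o1 o2 y))).
  by move=> u; apply/phi_three_cycle; rewrite val_cycH //; exists o1, o2, y.
have uy : uniq [:: o1; o2; y0] by rewrite -(rot_uniq 2) /= y0N inE o12.
have uz : uniq [:: o1; o2; z0].
  by move: uyz; rewrite /= !inE !negb_or => N; split_neqs; eval_eqs.
have [p [q [r [s [pqrs yE zE]]]]] := linked_shape (C3 _ uy) (C3 _ uz) (L _ _ uyz).
exists p, q => y u.
case: (eqVneq y y0) => [->|yy0].
  exists r => //.
  by move: pqrs; rewrite /= !inE !negb_or => N; split_neqs; eval_eqs.
case: (eqVneq y z0) => [->|yz0].
  exists s => //.
  by move: pqrs; rewrite /= !inE !negb_or => N; split_neqs; eval_eqs.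
apply: (linked_common pqrs (C3 _ u)).
  rewrite -yE; apply: L; move: u uy; rewrite /= !inE !negb_or => N N1.
  by split_neqs; eval_eqs.
rewrite -zE; apply: L; move: u uz; rewrite /= !inE !negb_or => N N1.
by split_neqs; eval_eqs.
Qed.

(** When sigma is a permutation, this says that phi conjugates u by sigma; it is also
meaningful, and stable under the group operations, before sigma is known to be
onto. *)
Definition intertwines (sigma : X -> X) u :=
  forall x, sigma (val u x) = val (phi u) (sigma x).

Lemma intertwinesM sigma u v :
  intertwines sigma u -> intertwines sigma v -> intertwines sigma (u * v).
Proof. by move=> su sv x; rewrite gmulfM !svM !sym_mulE sv su. Qed.

Lemma intertwinesV sigma u : intertwines sigma u -> intertwines sigma u^-1.
Proof.
move=> su x; rewrite multiplicativeV !svV -{2}(sym_mulEV (val u) x) su.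
by rewrite sym_mulVE.
Qed.

Lemma intertwinesJ sigma u v :
  intertwines sigma u -> intertwines sigma v -> intertwines sigma (u ^ v).
Proof.
by move=> su sv; rewrite conjgE; do 2?apply: intertwinesM; rewrite //;
   exact: intertwinesV.
Qed.

Lemma cycHV a b c : uniq [:: a; b; c] -> (cycH a b c)^-1 = cycH a c b.
Proof.
move=> abc; apply: val_inj; rewrite svV !val_cycH ?cycV //.
exact: uniq_flip3.
Qed.

Lemma cycH_rot a b c : uniq [:: a; b; c] -> cycH a b c = cycH b c a.
Proof. by rewrite /cycH => /cyc_rot->. Qed.

Lemma intertwiner_base o1 o2 : o1 != o2 -> exists2 sigma : X -> X,
  injective sigma &
  forall y, uniq [:: o1; o2; y] -> intertwines sigma (cycH o1 o2 y).
Proof.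
move=> o12; have [p [q pq]] := phi_pivot o12.
(* The image of (o1 o2 x) is some (p q t), which sends q to t: so t is read off. *)
pose sigma x := if x == o1 then p else if x == o2 then q
                else val (phi (cycH o1 o2 x)) q.
have sE y : uniq [:: o1; o2; y] -> uniq [:: p; q; sigma y] /\
    val (phi (cycH o1 o2 y)) = cyc p q (sigma y).
  move=> u; have [t pqt E] := pq y u.
  suff -> : sigma y = t by [].
  rewrite /sigma; move: u; rewrite /= !inE !negb_or => N; split_neqs.
  by eval_eqs; rewrite E cyc_2.
have s1 : sigma o1 = p by rewrite /sigma eqxx.
have s2 : sigma o2 = q by rewrite /sigma eqxx eq_sym (negbTE o12).
have uy y : y != o1 -> y != o2 -> uniq [:: o1; o2; y].
  by move=> y1 y2; rewrite /= !inE; eval_eqs.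
have sp y : y != o1 -> sigma y != p.
  move=> y1; have [->|y2] := eqVneq y o2.
    have [z zN] := X_infinite [:: o1; o2].
    have [|+ _] := sE z; first by rewrite -(rot_uniq 2) /= zN inE o12.
    by rewrite s2 /= !inE !negb_or => N; split_neqs; eval_eqs.
  have [+ _] := sE _ (uy y y1 y2).
  by rewrite /= !inE !negb_or => N; split_neqs; eval_eqs.
have sq y : y != o1 -> y != o2 -> sigma y != q.
  move=> y1 y2; have [+ _] := sE _ (uy y y1 y2).
  by rewrite /= !inE !negb_or => N; split_neqs; eval_eqs.
have sI : injective sigma.
  move=> x y sxy.
  have [x1|x1] := eqVneq x o1; have [y1|y1] := eqVneq y o1.
  - by rewrite x1 y1.
  - by move: (sp y y1); rewrite -sxy x1 s1 eqxx.
  - by move: (sp x x1); rewrite sxy y1 s1 eqxx.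
  have [x2|x2] := eqVneq x o2; have [y2|y2] := eqVneq y o2.
  - by rewrite x2 y2.
  - by move: (sq y y1 y2); rewrite -sxy x2 s2 eqxx.
  - by move: (sq x x1 x2); rewrite sxy y2 s2 eqxx.
  have [_ Ex] := sE _ (uy x x1 x2); have [_ Ey] := sE _ (uy y y1 y2).
  have /val_inj/(bij_inj phi_bij)/(congr1 val) :
      val (phi (cycH o1 o2 x)) = val (phi (cycH o1 o2 y)) by rewrite Ex Ey sxy.
  rewrite !val_cycH ?uy // => /(congr1 (fun p : Sym X => p o2)).
  by rewrite !cyc_2 ?uy.
exists sigma => // y u x; have [_ ->] := sE y u.
by rewrite val_cycH // cyc_injective_image // s1 s2.
Qed.

(** Every 3-cycle is obtained from the cycles (o1 o2 y) by inversion and conjugation. *)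
Lemma intertwiner_cycles : exists2 sigma : X -> X, injective sigma &
  forall a b c, uniq [:: a; b; c] -> intertwines sigma (cycH a b c).
Proof.
have [o1 _] := X_infinite [::]; have [o2] := X_infinite [:: o1].
rewrite inE eq_sym => o12; have [sigma sI base] := intertwiner_base o12.
exists sigma => //.
have with_o1 b c : uniq [:: o1; b; c] -> intertwines sigma (cycH o1 b c).
  move=> u; have [b2|b2] := eqVneq b o2; first by subst b; exact: base.
  have [c2|c2] := eqVneq c o2.
    subst c; rewrite -cycHV ?(uniq_flip3 u) //.
    by apply/intertwinesV/base; exact: uniq_flip3.
  have [ub uc] : uniq [:: o1; o2; b] /\ uniq [:: o1; o2; c].
    by move: u; rewrite /= !inE !negb_or => N; split_neqs; eval_eqs.
  have uf := uniq_flip3 uc.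
  have := intertwinesJ (base _ ub) (intertwinesV (base _ uc)).
  have bN : b \notin [:: o1; c; o2].
    by move: u; rewrite /= !inE !negb_or => N; split_neqs; eval_eqs.
  rewrite cycHJ // cycHV // val_cycH // cyc_1 // cyc_3 // cyc_out //.
  by rewrite cycH_rot // -(rot_uniq 1).
move=> a b c abc; have bca := uniq_rot3 abc; have cab := uniq_rot3 bca.
have [a1|a1] := eqVneq a o1; first by subst a; exact: with_o1.
have [b1|b1] := eqVneq b o1.
  by subst b; rewrite cycH_rot //; exact: with_o1.
have [c1|c1] := eqVneq c o1.
  by subst c; rewrite -cycH_rot //; exact: with_o1.
(* (a b c) is the conjugate of (o1 b c) by (o1 a d), for any fresh point d. *)
have [d dN] := X_infinite [:: o1; a; b; c].
move: (abc) dN; rewrite /= !inE !negb_or => N N1; split_neqs.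
have u1 : uniq [:: o1; b; c] by rewrite /= !inE; eval_eqs.
have u2 : uniq [:: o1; a; d] by rewrite /= !inE; eval_eqs.
have := intertwinesJ (with_o1 _ _ u1) (with_o1 _ _ u2).
by rewrite cycHJ // val_cycH // cyc_1 // !cyc_out // !inE; eval_eqs.
Qed.

(** If z were not a value of sigma, write a 3-cycle through z as the image of a 3-cycle
(a b c): it then moves the three points sigma a, sigma b, sigma c, all different
from z, and this leaves no room for z in its support. *)
Lemma intertwiner_surjective (sigma : X -> X) : injective sigma ->
  (forall a b c, uniq [:: a; b; c] -> intertwines sigma (cycH a b c)) ->
  forall z, exists x, sigma x = z.
Proof.
move=> sI sC z; apply: contrapT => /forallNP zN.
have [z1 z1N] := X_infinite [:: z]; have [z2 z2N] := X_infinite [:: z; z1].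
have uz : uniq [:: z; z1; z2].
  by move: z1N z2N; rewrite /= !inE !negb_or => N N1; split_neqs; eval_eqs.
have [psi _ psiK] := phi_bij.
pose u := psi (cycH z z1 z2).
have phiu : val (phi u) = cyc z z1 z2 by rewrite psiK val_cycH.
have [a [b [c [abc uE]]]] : three_cycle (val u).
  by apply/phi_three_cycle; rewrite phiu; exists z, z1, z2.
have {}sC : intertwines sigma u.
  by have -> : u = cycH a b c; [apply: val_inj; rewrite val_cycH|exact: sC].
have moved x y : val u x = y -> x != y -> sigma x \in [:: z1; z2].
  move=> <- xy; have sx : cyc z z1 z2 (sigma x) != sigma x.
    by rewrite -phiu -sC (inj_eq sI) eq_sym.
  have: sigma x \in [:: z; z1; z2] by apply: contraNT sx => /cyc_out->.
  by rewrite inE => /orP[/eqP/zN|].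
have sub : {subset map sigma [:: a; b; c] <= [:: z1; z2]}.
  move: (abc); rewrite /= !inE !negb_or => N; split_neqs.
  move=> y; rewrite 3!in_cons in_nil orbF => /or3P[]/eqP->.
  - by apply: (moved a b) => //; rewrite uE cyc_1.
  - by apply: (moved b c) => //; rewrite uE cyc_2.
  - by apply: (moved c a); [rewrite uE cyc_3|eval_eqs].
by have := uniq_leq_size _ sub; rewrite map_inj_uniq // => /(_ abc).
Qed.

(** By the previous lemmas phi acts on 3-cycles as conjugation by a permutation s.  For
u in G, the images of the conjugate of a 3-cycle by u can then be computed in two
ways, which shows that u * s and s * phi u act alike on all 3-cycles; so they are
equal. *)
Lemma automorphism_inner : exists s : Sym X, forall u, val (phi u) = val u ^ s.
Proof.
have [sigma sI sC] := intertwiner_cycles.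
have [tau tauK] := choice (intertwiner_surjective sI sC).
pose s : Sym X := @MkSym X sigma tau (inj_can_sym tauK sI) tauK.
have sE u : intertwines sigma u -> val (phi u) = val u ^ s.
  move=> su; apply: symP => x; rewrite -(sym_mulEV s x) sym_conjE.
  by rewrite -[RHS]/(sigma _) su.
have sCJ (u : H) a b c : uniq [:: a; b; c] -> intertwines sigma (cycH a b c ^ u).
  move=> abc; rewrite cycHJ //; apply: sC.
  by apply: uniq_image3 abc; exact: sym_fun_inj.
exists s => u.
suff : val u * s = s * val (phi u) by move=> us; rewrite conjgE us mulKg.
apply/divg1_eq/central_on_cycles => a b c abc.
rewrite conjgM -[X in _ = X](conjgK (s * val (phi u))); congr (_ ^ _).
rewrite !conjgM -(val_cycH abc) -svJ -(sE _ (sCJ u _ _ _ abc)).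
by rewrite multiplicativeJ svJ (sE _ (sC _ _ _ abc)).
Qed.

End Automorphism.

(** * Infinitely many twisted classes *)

(** Both cases iterate multiplication by 3-cycles; the chain decreases when s has
infinitely many fixed points and increases otherwise. *)
Lemma fixes_chain s : exists T : nat -> Sym X,
  (forall n, s^-1 * T n \in G) /\
  (forall m n, (m < n)%N ->
     fixes (T m) `<` fixes (T n) \/ fixes (T n) `<` fixes (T m)).
Proof.
have proper_trans (B A C : set X) : A `<` B -> B `<` C -> A `<` C.
  move=> [AB nBA] [BC nCB]; split; first exact: subset_trans BC.
  by move=> CA; apply: nBA; exact: subset_trans CA.
have iterate (P : Sym X -> Prop) (R : set X -> set X -> Prop) :
    (forall B A C, R A B -> R B C -> R A C) -> P s ->
    (forall t, P t -> exists a b c, [/\ uniq [:: a; b; c],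
       R (fixes t) (fixes (t * cyc a b c)) & P (t * cyc a b c)]) ->
    exists T : nat -> Sym X, (forall n, s^-1 * T n \in G) /\
      {homo T : m n / (m < n)%N >-> R (fixes m) (fixes n)}.
  move=> Rtrans Ps step.
  have /choice[F FP] : forall t, exists t', P t ->
      [/\ t^-1 * t' \in G, R (fixes t) (fixes t') & P t'].
    move=> t; have [Pt|nPt] := pselect (P t); last by exists t.
    have [a [b [c [abc Rt Pt']]]] := step t Pt; exists (t * cyc a b c) => _.
    by split; rewrite // mulKg; exact: cycG.
  have PT n : P (iter n F s) by elim: n => // n /FP[].
  exists (fun n => iter n F s); split.
    elim=> [|n IHn]; first by rewrite /= mulVg; exact: gpred1.
    have [tG _ _] := FP _ (PT n).
    rewrite /= -[F _](mulVKg (iter n F s)) mulgA.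
    by apply: gpredM.
  apply: (@homo_ltn _ (fun n => fixes (iter n F s)) R Rtrans) => n.
  by have [] := FP _ (PT n).
have [us|ns] := pselect (unbounded (fixes s)).
  have [|T [TG TR]] := iterate _ (fun A B => B `<` A) _ us (@mul_cyc_fewer_fixes X).
    by move=> B A C BA CB; exact: proper_trans BA.
  by exists T; split=> // m n mn; right; exact: TR.
have us : unbounded (~` fixes s).
  move: ns => /existsNP[r /forall2NP rs] r'.
  have [x] := X_infinite (r ++ r'); rewrite mem_cat negb_or => /andP[xr xr'].
  by exists x => //; case: (rs x).
have [T [TG TR]] := iterate _ _ proper_trans us (@mul_cyc_more_fixes X).
by exists T; split=> // m n mn; left; exact: TR.
Qed.

(** If phi is conjugation by s, a twisted conjugation from s^-1 * t to s^-1 * t' is an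
ordinary conjugation from t to t'; so the elements s^-1 * T n, for T as in
[fixes_chain], lie in different classes. *)
Lemma subgroup_R_infty :
  (forall g x, g \in G -> finite_set (sym_orbit g x)) -> R_infty H.
Proof.
move=> fin_orb phi phi_bij; have [s phiE] := automorphism_inner phi_bij.
have [T [TG T_chain]] := fixes_chain s.
pose a n : H := MkSubgroup (TG n).
have a_sep m n : (m < n)%N -> ~ twisted_conj phi (a m) (a n).
  move=> mn [x /(congr1 val)]; rewrite !svM phiE svV => E.
  have {}E : T m ^ val x = T n.
    apply: (mulgI s^-1); rewrite -[RHS]/(val (a n)) -E /= !conjgE !mulgA.
    by rewrite mulgK.
  have /fixes_comparable_eq : forall y, finite_set (sym_orbit (val x) y).
    by move=> y; apply: fin_orb; exact: subgroup_valP.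
  move=> /(_ (T m)); rewrite E.
  by case: (T_chain m n mn) => -[sub nsub] F; apply: nsub; rewrite F //;
     [left|right].
have refl n : twisted_conj phi (a n) (a n).
  by exists 1; rewrite invg1 multiplicative1 mul1g mulg1.
move=> fin; have : finite_set (range (fun n => twisted_conj phi (a n))).
  by apply: sub_finite_set fin => _ [n _ <-]; exists (a n).
rewrite (eq_finite_set (inj_card_eq _)); first exact: infinite_nat.
move=> m n _ _ mnE; have [mn|nm|//] := ltngtP m n.
  by case: (a_sep _ _ mn); rewrite mnE.
by case: (a_sep _ _ nm); rewrite -mnE.
Qed.

End SubgroupsContainingFAlt.

Theorem corollary3p6 (X : Type) (G : groupClosed (Sym X)) :
  infinite_set [set: X] ->
  (forall p : Sym X, FAlt X p -> p \in G) ->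
  (forall (g : Sym X) (x : X), g \in G -> finite_set (sym_orbit g x)) ->
  R_infty (subgroup G).
Proof.
(* Boolean equality of points comes from the classical structure on X. *)
move=> Xinf FG fin_orb; pose Y : eqType := {classic X}.
apply: (@subgroup_R_infty Y G) => //.
- move=> s; apply: contrapT => /forallNP sE; apply: Xinf.
  apply: (@sub_finite_set Y _ [set` s]); last exact: finite_seq.
  by move=> x _; apply: contrapT => /negP /sE.
- by move=> a b c abc; apply: FG; exact: (@FAlt_cyc Y).
Qed.
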